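(* For every real $x$ and every integer $n\ge 0$, $$\sum_{j=0}^{n}\sum_{l=0}^{j}\binom{n}{j}{j\brace l}_{\lambda}(1)_{n-j,\lambda}(-1)^{l}d_{l,\lambda}^{Y}(x)=\sum_{k=0}^{n}E\big[(x-Y)_{k,\lambda}\big](-1)^{k}{n\brace k}_{\lambda}.$$
   Context: Let $\lambda$ be a nonzero real number. Set $(x)_{0,\lambda}=1$, $(x)_{k,\lambda}=x(x-\lambda)\cdots(x-(k-1)\lambda)$ for $k\ge 1$, and $(x)_0=1$, $(x)_k=x(x-1)\cdots(x-k+1)$ for $k\ge1$. The degenerate exponential is $e_{\lambda}^{x}(t)=\sum_{k\ge 0}(x)_{k,\lambda}\frac{t^{k}}{k!}$ (so $e_\lambda^x(t)=(1+\lambda t)^{x/\lambda}$ for $t$ near $0$). The degenerate Stirling numbers of the second kind ${n\brace k}_{\lambda}$ are defined by $(x)_{n,\lambda}=\sum_{k=0}^{n}{n\brace k}_{\lambda}(x)_{k}$ for $n\ge 0$. $Y$ is a real random variable whose moment generating function $E[e^{tY}]=\sum_{n\ge 0}E[Y^n]\frac{t^n}{n!}$ exists for $|t|<r$, for some $r>0$. $E$ denotes expectation. The probabilistic degenerate derangement polynomials associated with $Y$, $d_{n,\lambda}^{Y}(x)$, are defined by $$\frac{1}{1-t}E\big[e_{\lambda}^{x-Y}(t)\big]=\sum_{n=0}^{\infty}d_{n,\lambda}^{Y}(x)\frac{t^{n}}{n!}$$ (power series in $t$ near $0$). *)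

(* Defs.v *)
From HB Require Import structures.
From mathcomp Require Import all_boot all_order all_algebra.
From mathcomp Require Import all_classical all_reals all_analysis.

Set Implicit Arguments.
Unset Strict Implicit.
Unset Printing Implicit Defensive.

Import Order.TTheory GRing.Theory Num.Theory.
Import numFieldNormedType.Exports.

Local Open Scope classical_set_scope.
Local Open Scope ring_scope.

Definition falling_fact (R : realType) (x : R) (k : nat) : R :=
  \prod_(i < k) (x - i%:R).

Definition deg_falling_fact (R : realType) (lam x : R) (k : nat) : R :=
  \prod_(i < k) (x - i%:R * lam).

(* The sum of the series; it converges for `|lam * t| < 1, and [limn] is a
   dummy value where it does not. *)
Definition deg_exp (R : realType) (lam x t : R) : R :=
  limn (pseries (fun k => deg_falling_fact lam x k / k`!%:R) t).

(* The connection coefficients from the deg_falling_fact basis to the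
   falling_fact basis, extended by 0 for n < k; these conditions determine
   S completely. *)
Definition is_deg_stirling2 (R : realType) (lam : R) (S : nat -> nat -> R) :=
  (forall n (x : R),
     deg_falling_fact lam x n = \sum_(k < n.+1) S n k * falling_fact x k) /\
  (forall n k, (n < k)%N -> S n k = 0).

Definition deg_stirling2 (R : realType) (lam : R) : nat -> nat -> R :=
  xget (fun _ _ => 0) [set S | is_deg_stirling2 lam S].

(* D is the coefficient sequence of the exponential generating function
   (1 - t)^-1 * E[e_lam^(x - Y)(t)], as an identity of functions of t on a
   neighbourhood of 0 where the expectation is finite; this determines D. *)
Definition is_prob_deg_derangement d (T : measurableType d) (R : realType)
    (P : probability T R) (Y : {RV P >-> R}) (lam x : R) (D : nat -> R) :=
  \forall t \near (0 : R),
    let E := 'E_P[fun w => deg_exp lam (x - Y w) t]%E in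
    E \is a fin_num /\
    pseries (fun n => D n / n`!%:R) t @ \oo --> (1 - t)^-1 * fine E.

(* Such a sequence exists when the moment generating function of Y is finite
   around 0; the default 0 is only relevant otherwise. *)
Definition prob_deg_derangement d (T : measurableType d) (R : realType)
    (P : probability T R) (Y : {RV P >-> R}) (lam : R) (n : nat) (x : R) : R :=
  xget (fun=> 0) [set D | is_prob_deg_derangement Y lam x D] n.

(* Main.v *)
Require Import Defs.
From HB Require Import structures.
From mathcomp Require Import all_boot all_order all_algebra.
From mathcomp Require Import all_classical all_reals all_analysis.
From mathcomp Require Import measurable_realfun ring lra.

Import Order.TTheory GRing.Theory Num.Theory.
Import numFieldNormedType.Exports.

Local Open Scope ring_scope.
Local Open Scope classical_set_scope.

(** Write S(n, k) for the degenerate Stirling numbers, (y)_k for the step-lam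
    falling factorials, a_k = E[(x - Y)_k] and d_k for the derangement numbers.

    Algebra. Dividing by 1 - t takes partial sums of coefficients, so the
    generating function says d_n / n! = sum_(m <= n) a_m / m!, that is
    d_0 = a_0 and d_(k+1) = (k + 1) d_k + a_(k+1).  On the other side,
    expanding (y + 1)_n in ordinary falling factorials of y in two ways, by the
    binomial theorem for (y + 1)_n and by the rule
    (y + 1)(y)...(y - l + 1) = (l + 1)-st factorial + (l + 1) times the l-th,
    gives, by linear independence,
      sum_j C(n, j) (1)_(n-j) S(j, l) = S(n, l) + (l + 1) S(n, l + 1)
    (deg_stirling2_binomial).  Hence the left-hand side of the theorem is
    sum_l (-1)^l d_l (S(n, l) + (l + 1) S(n, l + 1)), and summation by parts
    moves the shift onto d, leaving sum_l (-1)^l (d_l - l d_(l-1)) S(n, l),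
    where d_l - l d_(l-1) = a_l (deg_stirling2_derangement_sum).

    Analysis. The numbers d_n are specified only through the values of a
    generating function near 0, so two facts are needed.
    Existence: the expectation of the degenerate exponential may be computed
    term by term.  Since u^k / k! <= e^u for u >= 0, taking
    u = c (|y| + k |lam|) bounds |(y)_k| / k! by e^(c |y|) (e^(c |lam|) / c)^k
    (deg_falling_fact_bound); with c below the radius of the moment generating
    function, e^(c |x - Y|) is integrable, and it dominates all the partial sums
    once t is small (dominated_expectation_pseries).
    Uniqueness: a power series is determined by its sums on a neighbourhood of 0
    (pseries_coef_unique). *)

(** * Step-lambda falling factorials and degenerate Stirling numbers *)

Lemma deg_falling_fact0 {R : realType} (lam x : R) :
  deg_falling_fact lam x 0 = 1.
Proof. by rewrite /deg_falling_fact big_ord0. Qed.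

Lemma deg_falling_factS {R : realType} (lam x : R) n :
  deg_falling_fact lam x n.+1 = deg_falling_fact lam x n * (x - n%:R * lam).
Proof. by rewrite /deg_falling_fact big_ord_recr. Qed.

(** Binomial type: the factor x + y - n lam completing a product of degree n
    splits as (x - j lam) + (y - (n - j) lam), which raises one of the two
    degrees, and the coefficients recombine by Pascal's rule. *)
Lemma deg_falling_factD {R : realType} (lam x y : R) n :
  deg_falling_fact lam (x + y) n =
  \sum_(j < n.+1) 'C(n, j)%:R * deg_falling_fact lam x j *
                  deg_falling_fact lam y (n - j).
Proof.
elim: n => [|n IHn].
  by rewrite big_ord_recr big_ord0 /= bin0 subnn !deg_falling_fact0; ring.
rewrite big_ord_recl bin0 subn0.
under eq_bigr do rewrite /= /bump /= add1n binS natrD 2!mulrDl subSS.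
rewrite big_split /= addrA.
(* The first half of Pascal's rule together with the j = 0 term is the whole
   sum with coefficients 'C(n, j), because 'C(n, n.+1) = 0. *)
have -> : 1%:R * deg_falling_fact lam x 0 * deg_falling_fact lam y n.+1 +
    \sum_(i < n.+1) 'C(n, i.+1)%:R * deg_falling_fact lam x i.+1 *
                    deg_falling_fact lam y (n - i) =
    \sum_(j < n.+1) 'C(n, j)%:R * deg_falling_fact lam x j *
                    deg_falling_fact lam y (n.+1 - j).
  rewrite [in LHS]big_ord_recr [in RHS]big_ord_recl /= bin0 subn0 bin_small //.
  by rewrite !mul0r addr0.
rewrite deg_falling_factS IHn mulr_suml -big_split /=.
apply: eq_bigr => i _; rewrite subSn -1?ltnS // !deg_falling_factS natrB -1?ltnS //.
ring.
Qed.

Lemma falling_factS {R : realType} (x : R) k :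
  falling_fact x k.+1 = falling_fact x k * (x - k%:R).
Proof. by rewrite /falling_fact big_ord_recr. Qed.

Lemma falling_factD1 {R : realType} (x : R) k :
  falling_fact (x + 1) k.+1 = falling_fact x k.+1 + k.+1%:R * falling_fact x k.
Proof.
rewrite (falling_factS x) {1}/falling_fact big_ord_recl /=.
under eq_bigr do rewrite /bump /= natrD opprD addrA addrK.
by rewrite -/(falling_fact x k) -natr1; ring.
Qed.

(** At x = k the factorials of degree above k vanish and the k-th one is k!,
    so the evaluations at 0, 1, 2, ... form a triangular system. *)
Lemma falling_fact_free {R : realType} N (c : nat -> R) :
  (forall x : R, \sum_(k < N) c k * falling_fact x k = 0) ->
  forall k, (k < N)%N -> c k = 0.
Proof.
move=> c0; elim/ltn_ind => k IHk kN.
have kk_neq0 : falling_fact (k%:R : R) k != 0.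
  rewrite /falling_fact; apply/prodf_neq0 => i _.
  by rewrite subr_eq0 eqr_nat gtn_eqF.
have := c0 k%:R; rewrite (bigD1 (Ordinal kN)) //= big1 ?addr0 => [/eqP|i].
  by rewrite mulf_eq0 (negbTE kk_neq0) orbF => /eqP.
rewrite -val_eqE /= neq_ltn => /orP[ik|ki]; first by rewrite IHk ?mul0r.
by rewrite /falling_fact (bigD1 (Ordinal ki)) //= subrr mul0r mulr0.
Qed.

(** The recurrence comes from x - n lam = (x - k) + (k - n lam), applied to the
    term of index k of the expansion in degree n; its only purpose is to witness
    that connection coefficients exist. *)
Fixpoint deg_stirling2_rec {R : realType} (lam : R) (n k : nat) : R :=
  if n is n'.+1 then
    (k%:R - n'%:R * lam) * deg_stirling2_rec lam n' k +
    (if k is k'.+1 then deg_stirling2_rec lam n' k' else 0)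
  else (k == 0)%:R.

Lemma deg_stirling2_recP {R : realType} (lam : R) :
  is_deg_stirling2 lam (deg_stirling2_rec lam).
Proof.
have small n k : (n < k)%N -> deg_stirling2_rec lam n k = 0.
  elim: n k => [|n IHn] [|k] //= nk.
  by rewrite !IHn // 1?ltnW // mulr0 addr0.
split=> // n x; elim: n => [|n IHn].
  by rewrite big_ord_recr big_ord0 deg_falling_fact0 /falling_fact big_ord0 /=; ring.
rewrite deg_falling_factS IHn /=.
under [RHS]eq_bigr do rewrite mulrDl.
rewrite big_split /= [X in _ = X + _]big_ord_recr /= (small n n.+1) // mulr0 mul0r addr0.
rewrite [X in _ = _ + X]big_ord_recl /= mul0r add0r -big_split /= mulr_suml.
by apply: eq_bigr => i _; rewrite falling_factS; ring.
Qed.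

Lemma deg_stirling2P {R : realType} (lam : R) :
  is_deg_stirling2 lam (deg_stirling2 lam).
Proof.
by apply: (@xgetPex _ _ [set S | is_deg_stirling2 lam S]%classic);
  exists (deg_stirling2_rec lam); exact: deg_stirling2_recP.
Qed.

Lemma sum_ord_widen {V : nmodType} (F : nat -> V) m n :
  (m <= n)%N -> (forall i, (m <= i)%N -> F i = 0) ->
  \sum_(i < m) F i = \sum_(i < n) F i.
Proof.
move=> mn F0; rewrite (big_ord_widen _ _ mn) big_mkcond /=.
by apply: eq_bigr => i _; case: ltnP => // /F0.
Qed.

Lemma deg_falling_fact_stirling2 {R : realType} (lam x : R) j n :
  (j <= n)%N ->
  deg_falling_fact lam x j =
  \sum_(l < n.+1) deg_stirling2 lam j l * falling_fact x l.
Proof.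
have [S_def S0] := deg_stirling2P lam.
move=> jn; rewrite S_def.
apply: (sum_ord_widen (fun l => deg_stirling2 lam j l * falling_fact x l)) => // i ji.
by rewrite S0 ?mul0r.
Qed.

(** Both sides are the coefficient of falling_fact x l in
    deg_falling_fact lam (x + 1) n: the left one by binomial type with
    y = 1, the right one by falling_factD1. *)
Lemma deg_stirling2_binomial {R : realType} (lam : R) n l :
  (l <= n)%N ->
  \sum_(j < n.+1) 'C(n, j)%:R * deg_falling_fact lam 1 (n - j) *
                  deg_stirling2 lam j l =
  deg_stirling2 lam n l + l.+1%:R * deg_stirling2 lam n l.+1.
Proof.
have [S_def S0] := deg_stirling2P lam.
move=> ln; apply/eqP; rewrite -subr_eq0; apply/eqP.
pose c l := \sum_(j < n.+1) 'C(n, j)%:R * deg_falling_fact lam 1 (n - j) *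
  deg_stirling2 lam j l - (deg_stirling2 lam n l + l.+1%:R * deg_stirling2 lam n l.+1).
apply: (falling_fact_free n.+1 c) => // x; rewrite {}/c {l ln}.
under eq_bigr do rewrite mulrBl; rewrite sumrB; apply/eqP; rewrite subr_eq0; apply/eqP.
transitivity (deg_falling_fact lam (x + 1) n).
  rewrite deg_falling_factD.
  under eq_bigr do rewrite mulr_suml; rewrite exchange_big /=.
  apply: eq_bigr => j _.
  rewrite (deg_falling_fact_stirling2 lam x j n) -1?ltnS // mulr_sumr mulr_suml.
  by apply: eq_bigr => l _; ring.
under [RHS]eq_bigr do rewrite mulrDl.
rewrite S_def big_split /= [X in _ = _ + X]big_ord_recr /= (S0 n n.+1) //.
rewrite mulr0 mul0r addr0 !big_ord_recl -addrA -big_split /=; congr (_ + _).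
  by rewrite /falling_fact !big_ord0.
by apply: eq_bigr => i _; rewrite /bump /= !add1n falling_factD1; ring.
Qed.

(** Summation by parts: by deg_stirling2_binomial the inner sums over j become
    S n l + (l + 1) S n (l + 1), and shifting l by one in the second part
    leaves the combination D l - l D (l - 1), which is a l. *)
Lemma deg_stirling2_derangement_sum {R : realType} (lam : R) (D a : nat -> R) n :
  D 0 = a 0 -> (forall k, D k.+1 = k.+1%:R * D k + a k.+1) ->
  \sum_(j < n.+1) \sum_(l < j.+1)
     'C(n, j)%:R * deg_stirling2 lam j l * deg_falling_fact lam 1 (n - j) *
     (-1) ^+ l * D l =
  \sum_(k < n.+1) a k * ((-1) ^+ k * deg_stirling2 lam n k).
Proof.
move=> D0 DS; have [_ S0] := deg_stirling2P lam.
transitivity (\sum_(j < n.+1) \sum_(l < n.+1)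
     'C(n, j)%:R * deg_falling_fact lam 1 (n - j) * deg_stirling2 lam j l *
     ((-1) ^+ l * D l)).
  apply: eq_bigr => j _.
  rewrite (sum_ord_widen (fun l => 'C(n, j)%:R * deg_stirling2 lam j l *
    deg_falling_fact lam 1 (n - j) * (-1) ^+ l * D l) j.+1 n.+1) //.
    by apply: eq_bigr => l _; ring.
  by move=> l jl; rewrite S0 // mulr0 !mul0r.
rewrite exchange_big /=.
under eq_bigr => l _ do rewrite -mulr_suml deg_stirling2_binomial -1?ltnS // mulrDl.
rewrite big_split /= [X in _ + X]big_ord_recr /= (S0 n n.+1) // mulr0 mul0r addr0.
rewrite !big_ord_recl -addrA -big_split /= D0; congr (_ + _); first by ring.
by apply: eq_bigr => i _; rewrite /bump /= add1n DS exprS; ring.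
Qed.

(** * Power series near the origin *)

Lemma sum_geometric_le2 {R : realFieldType} (z : R) n :
  0 <= z -> z <= 2^-1 -> \sum_(i < n) z ^+ i <= 2.
Proof.
move=> z0 z2; have S0 : 0 <= \sum_(i < n) z ^+ i.
  by apply: sumr_ge0 => i _; rewrite exprn_ge0.
have := subrX1 z n; have := exprn_ge0 n z0; nra.
Qed.

(** The series converges at s = e / 2, so its terms are bounded there by some K;
    at s u the terms after the first then add up to at most 2 K u.  As
    the sum is 0, this bounds the constant term, and u is arbitrarily small. *)
Lemma pseries_cvg0_head {R : realType} (c : nat -> R) (e : R) :
  0 < e -> (forall t, 0 < t < e -> pseries c t @ \oo --> (0 : R)) -> c 0 = 0.
Proof.
move=> e0 c_cvg0.
pose s := e / 2; have s0 : 0 < s by rewrite divr_gt0.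
have s_e : 0 < s < e by rewrite s0 /= /s; lra.
have /cvgP/cvg_series_bounded[K' [_ c_le]] := c_cvg0 _ s_e.
have {c_le} := c_le (`|K'| + 1); rewrite (le_lt_trans (ler_norm _)) ?ltrDl //.
move=> /(_ isT); set K := `|K'| + 1 => c_le.
have {}c_le i : `|c i| * s ^+ i <= K.
  by have := c_le i I; rewrite /= normrM normrX (gtr0_norm s0).
have K0 : 0 < K by rewrite /K ltr_wpDl.
have c0_le u : 0 < u -> u <= 2^-1 -> `|c 0| <= 2 * K * u.
  move=> u0 u2; have su : 0 < s * u < e by rewrite mulr_gt0 //= /s; nra.
  have -> : `|c 0| = `|0 - c 0| by rewrite sub0r normrN.
  have sub_cvg : pseries c (s * u) n - c 0 @[n --> \oo] --> (0 - c 0 : R).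
    by apply: cvgB; [exact: c_cvg0 | exact: cvg_cst].
  have <- := cvg_lim (@Rhausdorff R) (cvg_norm sub_cvg).
  apply: limr_le; first exact: cvgP (cvg_norm sub_cvg).
  exists 1%N => // -[//|n] _.
  rewrite /pseries /series /= big_mkord big_ord_recl expr0 mulr1 addrC addKr.
  apply: le_trans (ler_norm_sum _ _ _) _.
  apply: (@le_trans _ _ (\sum_(i < n) K * u * u ^+ i)).
    apply: ler_sum => i _; rewrite !lift0 exprMn mulrA normrM (normrX _ u) (gtr0_norm u0).
    rewrite normrM normrX (gtr0_norm s0) (exprS u) -(mulrA K).
    by rewrite ler_wpM2r ?mulr_ge0 ?exprn_ge0 // ltW.
  rewrite -mulr_sumr mulrC -mulrA ler_wpM2r ?mulr_ge0 ?(ltW K0) ?(ltW u0) //.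
  by rewrite sum_geometric_le2 // ltW.
have cK : `|c 0| <= K by have := c_le 0; rewrite expr0 mulr1.
have [//|c0] := eqVneq (c 0) 0.
have c0_gt0 : 0 < `|c 0| by rewrite normr_gt0.
(* At this u the bound reads |c 0| <= |c 0| / 2. *)
have := c0_le (`|c 0| / (4 * K)); rewrite divr_gt0 ?mulr_gt0 // => /(_ isT).
have -> : 2 * K * (`|c 0| / (4 * K)) = `|c 0| / 2.
  by field; rewrite gt_eqF.
rewrite ler_pdivrMr ?mulr_gt0 //.
have -> : `|c 0| <= 2^-1 * (4 * K) by nra.
by move=> /(_ isT); nra.
Qed.

(** Once the constant term is known to vanish, dividing by t gives another
    series of sum 0, with shifted coefficients.  The division is the reason
    for asking convergence at positive t only. *)
Lemma pseries_cvg0_coef {R : realType} (c : nat -> R) (e : R) :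
  0 < e -> (forall t, 0 < t < e -> pseries c t @ \oo --> (0 : R)) ->
  forall n, c n = 0.
Proof.
move=> e0 + n; elim: n c => [|n IHn] c c_cvg0; first exact: pseries_cvg0_head c_cvg0.
have c0 : c 0 = 0 by exact: pseries_cvg0_head c_cvg0.
apply: (IHn (fun i => c i.+1)) => t t_e.
have t_neq0 : t != 0 by case/andP: t_e => /gt_eqF ->.
have -> : pseries (fun i => c i.+1) t = fun N => t^-1 * pseries c t N.+1.
  apply/funext => N; rewrite /pseries /series /= !big_mkord big_ord_recl c0 mul0r.
  rewrite add0r mulr_sumr; apply: eq_bigr => i _.
  by rewrite !lift0 exprS; field.
rewrite -[X in _ --> X](mulr0 t^-1); apply: cvgM; first exact: cvg_cst.
by rewrite cvg_shiftS; exact: c_cvg0.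
Qed.

Lemma pseriesB {R : realType} (a b : nat -> R) t :
  pseries (fun n => a n - b n) t = pseries a t \- pseries b t.
Proof.
apply/funext => N; rewrite /pseries /series /= -sumrB.
by apply: eq_bigr => i _; rewrite mulrBl.
Qed.

Lemma pseries_coef_unique {R : realType} (a b : nat -> R) (f : R -> R) :
  (\forall t \near (0 : R), pseries a t @ \oo --> f t) ->
  (\forall t \near (0 : R), pseries b t @ \oo --> f t) ->
  a = b.
Proof.
move=> a_f b_f; have [e /= e0 ab_f] := (nbhs_ballP _ _).1 (filterI a_f b_f).
apply/funext => n; apply/eqP; rewrite -subr_eq0; apply/eqP; move: n.
apply: (pseries_cvg0_coef (fun n => a n - b n) e e0) => t /andP[t0 te].
have [] := ab_f t; first by rewrite /ball /= sub0r normrN gtr0_norm.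
by rewrite pseriesB -(subrr (f t)); exact: cvgB.
Qed.

(** Multiplying the partial sums of the new series by 1 - t telescopes to those of
    the old one, up to a boundary term that tends to 0 because the sums of a
    grow at most like q ^ n. *)
Lemma cvg_pseries_partial_sums {R : realType} (a : nat -> R) (M q t s : R) :
  2 <= q -> (forall n, `|a n| <= M * q ^+ n) -> q * `|t| < 1 ->
  pseries a t @ \oo --> s ->
  pseries (fun n => \sum_(m < n.+1) a m) t @ \oo --> (1 - t)^-1 * s.
Proof.
move=> q2 a_le qt1 a_s; set b := fun n => _.
have t1 : 1 - t != 0.
  by rewrite subr_eq0; apply: contraTneq qt1 => <-; rewrite normr1 mulr1; lra.
(* The bound 2 <= q lets one more factor q absorb each summation step. *)
have b_le n : `|b n| <= M * q ^+ n.+1.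
  elim: n => [|n IHn].
    have := a_le 0; rewrite /b big_ord_recl big_ord0 addr0 expr0 mulr1 expr1 => aM.
    by have := normr_ge0 (a 0); nra.
  have -> : b n.+1 = b n + a n.+1 by rewrite /b big_ord_recr.
  apply: le_trans (ler_normD _ _) _; apply: le_trans (lerD IHn (a_le _)) _.
  have M0 : 0 <= M * q ^+ n.+1 := le_trans (normr_ge0 _) IHn.
  by rewrite (exprS q n.+1); nra.
have pseriesS c n : pseries c t n.+1 = pseries c t n + c n * t ^+ n.
  by rewrite /pseries /series /= big_nat_recr.
have telescope n : (1 - t) * pseries b t n.+1 = pseries a t n.+1 - b n * t ^+ n.+1.
  elim: n => [|n IHn].
    rewrite !pseriesS /pseries /series /= !big_geq //.
    by rewrite /b big_ord_recl big_ord0 expr0 expr1; ring.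
  rewrite !(pseriesS _ n.+1) mulrDr IHn.
  have -> : b n.+1 = b n + a n.+1 by rewrite /b big_ord_recr.
  by rewrite (exprS t n.+1); ring.
have b_cvg0 : b n * t ^+ n.+1 @[n --> \oo] --> (0 : R).
  apply: norm_cvg0; apply: (@squeeze_cvgr _ _ _ _ (cst 0) (fun n => M * (q * `|t|) ^+ n.+1)).
  - near=> n; rewrite normr_ge0 /= exprMn mulrA normrM normrX.
    by rewrite ler_wpM2r ?exprn_ge0.
  - exact: cvg_cst.
  - rewrite -[X in _ --> X](mulr0 M); apply: cvgM; first exact: cvg_cst.
    rewrite (cvg_shiftS (fun n => (q * `|t|) ^+ n)).
    by apply: cvg_expr; rewrite ger0_norm // mulr_ge0 //; lra.
rewrite -cvg_shiftS.
have -> : [sequence pseries b t n.+1]_n =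
    fun n => (1 - t)^-1 * (pseries a t n.+1 - b n * t ^+ n.+1).
  by apply/funext => n; rewrite -telescope mulKf.
apply: cvgM; first exact: cvg_cst.
rewrite -[s]subr0; apply: cvgB => //.
by rewrite (cvg_shiftS (pseries a t)).
Unshelve. all: by end_near. Qed.

(** * Expectation of a dominated random power series *)

Lemma exprn_fact_le_expR {R : realType} (y : R) k :
  0 <= y -> y ^+ k / k`!%:R <= expR y.
Proof.
move=> y0; case: k => [|k].
  by rewrite expr0 divr1; apply: le_trans (expR_ge1Dx y); rewrite lerDl.
by apply: le_trans (expR_ge1Dxn k y0); rewrite lerDr.
Qed.

(** Crudely |(y)_k| <= (|y| + k |lam|)^k, and u^k / k! <= e^u at
    u = c (|y| + k |lam|).  The rate c of growth in y is free: it will be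
    taken below the radius of the moment generating function. *)
Lemma deg_falling_fact_bound {R : realType} (lam y c : R) k : 0 < c ->
  `|deg_falling_fact lam y k / k`!%:R| <=
  expR (c * `|y|) * (expR (c * `|lam|) / c) ^+ k.
Proof.
move=> c0; have y_le : `|deg_falling_fact lam y k| <= (`|y| + k%:R * `|lam|) ^+ k.
  rewrite normr_prod -[X in _ ^+ X]card_ord -prodr_const.
  apply: ler_prod => i _; rewrite normr_ge0 /=.
  apply: le_trans (ler_normB _ _) _; rewrite lerD2l normrM ler_wpM2r //.
  by rewrite normr_nat ler_nat ltnW.
have yk_ge0 : 0 <= c * (`|y| + k%:R * `|lam|).
  by rewrite mulr_ge0 ?(ltW c0) // addr_ge0 // mulr_ge0.
have := exprn_fact_le_expR _ k yk_ge0.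
rewrite exprMn mulrDr mulrCA expRD expRM_natl.
have ck0 : 0 < c ^+ k by rewrite exprn_gt0.
rewrite exprMn exprVn mulrA ler_pdivlMr // normrM normfV normr_nat => le_exp.
apply: le_trans le_exp; rewrite mulrC mulrA ler_wpM2r ?invr_ge0 //.
by rewrite ler_wpM2l ?(ltW ck0).
Qed.

Section dominated_pseries.
Context d (T : measurableType d) (R : realType) (P : probability T R).
Variables (f : nat -> T -> R) (G : T -> R) (q : R).
Hypothesis mf : forall k, measurable_fun setT (f k).
Hypothesis intG : P.-integrable setT (EFin \o G).
Hypothesis q0 : 0 <= q.
Hypothesis f_le : forall k w, `|f k w| <= G w * q ^+ k.

Lemma dominated_coef_integrable k : P.-integrable setT (EFin \o f k).
Proof.
apply: le_integrable (integrableZl measurableT (q ^+ k) intG) => //.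
  by apply/measurable_EFinP; exact: mf.
move=> w _; rewrite /= lee_fin; apply: le_trans (f_le k w) _.
by rewrite mulrC ler_norm.
Qed.

Lemma dominated_coef_expectation_le k :
  `|fine 'E_P[f k]%E| <= fine 'E_P[G]%E * q ^+ k.
Proof.
have intf := dominated_coef_integrable k.
rewrite unlock -lee_fin EFinM -fine_abse ?integrable_fin_num //.
rewrite !fineK ?abse_fin_num ?integrable_fin_num //.
apply: le_trans (le_abse_integral _ measurableT (measurable_int _ intf)) _.
rewrite muleC -integralZl //; apply: ge0_le_integral => //.
- exact: (measurableT_comp _ (measurable_int _ intf)).
- exact: measurable_int (integrableZl measurableT _ intG).
- by move=> w _; rewrite /= lee_fin mulrC.
Qed.

(** Dominated convergence: for q |t| <= 1/2 the terms are at most G w / 2^k,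
    hence every partial sum is at most 2 G w. *)
Lemma dominated_expectation_pseries t : q * `|t| <= 2^-1 ->
  let E := 'E_P[fun w => limn (pseries (f ^~ w) t)]%E in
  E \is a fin_num /\ pseries (fun k => fine 'E_P[f k]%E) t @ \oo --> fine E.
Proof.
move=> qt E; have qt0 : 0 <= q * `|t| by rewrite mulr_ge0.
have G0 w : 0 <= G w by have := f_le 0 w; rewrite expr0 mulr1; apply: le_trans.
have term_le k w : `|f k w * t ^+ k| <= G w * (q * `|t|) ^+ k.
  by rewrite normrM normrX exprMn mulrA ler_wpM2r ?exprn_ge0.
have cvg_f w : pseries (f ^~ w) t @ \oo --> limn (pseries (f ^~ w) t).
  apply: normed_cvg.
  apply: (series_le_cvg _ _ (fun k => term_le k w)) => [k|k|].
  - exact: normr_ge0.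
  - exact: geometric_ge0.
  - by apply: is_cvg_geometric_series; rewrite ger0_norm //; lra.
have mterm k : measurable_fun setT (fun w => f k w * t ^+ k).
  by apply: measurable_funM => //; exact: mf.
have mseries n : measurable_fun setT (fun w => pseries (f ^~ w) t n).
  by apply: measurable_sum => k; exact: mterm.
have mlim : measurable_fun setT (fun w => limn (pseries (f ^~ w) t)).
  exact: (measurable_realfun.measurable_fun_cvg mseries (fun w _ => cvg_f w)).
have partial_le n w : `|pseries (f ^~ w) t n| <= 2 * G w.
  rewrite /pseries /series /= big_mkord; apply: le_trans (ler_norm_sum _ _ _) _.
  apply: (@le_trans _ _ (\sum_(i < n) G w * (q * `|t|) ^+ i)).
    by apply: ler_sum => i _; exact: term_le.
  by rewrite -mulr_sumr mulrC ler_wpM2r // sum_geometric_le2.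
have [intlim _ cvg_int] : [/\
    P.-integrable setT (fun w => (limn (pseries (f ^~ w) t))%:E), True &
    \int[P]_w (pseries (f ^~ w) t n)%:E @[n --> \oo] -->
    \int[P]_w (limn (pseries (f ^~ w) t))%:E]%E.
  have [] := @dominated_convergence _ T R P setT measurableT
    (fun n w => (pseries (f ^~ w) t n)%:E) (fun w => (limn (pseries (f ^~ w) t))%:E)
    (fun w => (2 * G w)%R%:E).
  - by move=> n; apply/measurable_EFinP; exact: mseries.
  - by apply/measurable_EFinP.
  - by apply: aeW => w _; apply: cvg_EFin; [exact: nearW | exact: cvg_f].
  - exact: (integrableZl measurableT (2 : R) intG).
  - by apply: aeW => w n _; rewrite /= lee_fin.
  by split.
have E_fin : E \is a fin_num by rewrite /E unlock integrable_fin_num.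
split=> //; have -> : pseries (fun k => fine 'E_P[f k]%E) t =
    fine \o (fun n => \int[P]_w (pseries (f ^~ w) t n)%:E)%E.
  apply/funext => n; rewrite /pseries /series /=.
  have int_term k : P.-integrable setT (fun w => (f k w * t ^+ k)%:E).
    apply: le_integrable (integrableZl measurableT (t ^+ k) (dominated_coef_integrable k)) => //.
      by apply/measurable_EFinP; exact: mterm.
    by move=> w _; rewrite /= lee_fin mulrC.
  under [in RHS]eq_integral do rewrite -sumEFin.
  rewrite integral_sum // -sum_fine => [|k _]; last exact: integrable_fin_num.
  apply: eq_bigr => k _; have intf := dominated_coef_integrable k.
  under [in RHS]eq_integral do rewrite mulrC EFinM.
  by rewrite integralZl // fineM ?integrable_fin_num //= unlock mulrC.
by apply: fine_cvg; rewrite fineK // /E unlock.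
Qed.
End dominated_pseries.

(** * Probabilistic degenerate derangement numbers *)

Lemma measurable_deg_falling_fact d (T : measurableType d) (R : realType)
    (lam : R) k (g : T -> R) :
  measurable_fun setT g ->
  measurable_fun setT (fun w => deg_falling_fact lam (g w) k).
Proof.
move=> mg; apply: measurable_prod => i _.
by apply: measurable_funB => //; exact: measurable_cst.
Qed.

Lemma mgf_integrable d (T : measurableType d) (R : realType)
    (P : probability T R) (Y : {RV P >-> R}) (c : R) :
  ('M_P Y c < +oo)%E -> P.-integrable setT (fun w => (expR (Y w * c))%:E).
Proof.
rewrite /mmt_gen_fun unlock /= => MYc; apply/integrableP; split.
  apply/measurable_EFinP; apply: measurableT_comp; first exact: measurable_expR.
  by apply: measurable_funM => //; exact: measurable_cst.
by under eq_integral do rewrite /= (ger0_norm (expR_ge0 _)).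
Qed.

(** e^(c |Y|) <= e^(c Y) + e^(- c Y), so two values of the moment generating
    function control it. *)
Lemma exp_abs_integrable d (T : measurableType d) (R : realType)
    (P : probability T R) (Y : {RV P >-> R}) (c x : R) :
  0 < c -> ('M_P Y c < +oo)%E -> ('M_P Y (- c) < +oo)%E ->
  P.-integrable setT (EFin \o (fun w => expR (c * `|x - Y w|))).
Proof.
move=> c0 /mgf_integrable intp /mgf_integrable intn.
have int_bound := integrableZl measurableT (expR (c * `|x|))
  (integrableD measurableT intp intn).
apply: le_integrable int_bound => //.
  apply/measurable_EFinP; apply: measurableT_comp; first exact: measurable_expR.
  apply: measurable_funM; first exact: measurable_cst.
  apply: measurableT_comp => //; apply: measurable_funB => //.
move=> w _; rewrite /= lee_fin (ger0_norm (expR_ge0 _)).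
apply: le_trans (ler_norm _).
apply: (@le_trans _ _ (expR (c * `|x|) * expR (c * `|Y w|))).
  by rewrite -expRD ler_expR -mulrDr ler_wpM2l ?(ltW c0) // ler_normB.
rewrite ler_wpM2l ?expR_ge0 // mulrN [Y w * c]mulrC -mulrN.
by case: (ger0P (Y w)) => _; rewrite ?mulrN ?lerDl ?lerDr expR_ge0.
Qed.

Section derangement.
Context d (T : measurableType d) (R : realType) (P : probability T R).
Variables (Y : {RV P >-> R}) (lam x : R).
Hypothesis mgfY : exists2 r : R, 0 < r &
  forall t : R, `|t| < r -> ('M_P Y t < +oo)%E.

Let a k := fine 'E_P[fun w => deg_falling_fact lam (x - Y w) k]%E.

Let f k w := deg_falling_fact lam (x - Y w) k / k`!%:R.

(** The domination needed to exchange expectation and summation, with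
    G = e^(c |x - Y|) for c half the given radius.  The rate q is enlarged
    to be at least 2 for the sake of cvg_pseries_partial_sums. *)
Lemma deg_falling_fact_dominated : exists G : T -> R, exists2 q : R,
  2 <= q & P.-integrable setT (EFin \o G) /\ forall k w, `|f k w| <= G w * q ^+ k.
Proof.
have [r r0 Mr] := mgfY; pose c := r / 2; have c0 : 0 < c by rewrite divr_gt0.
have c_r : c < r by rewrite /c; lra.
exists (fun w => expR (c * `|x - Y w|)), (2 + expR (c * `|lam|) / c).
  by rewrite lerDl divr_ge0 ?expR_ge0 ?ltW.
split.
  by apply: exp_abs_integrable; rewrite ?Mr // ?normrN gtr0_norm.
move=> k w; apply: le_trans (deg_falling_fact_bound _ _ _ _ c0) _.
rewrite ler_wpM2l ?expR_ge0 // lerXn2r ?nnegrE ?addr_ge0 ?divr_ge0 ?expR_ge0 ?(ltW c0) ?(ltW r0) //.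
by rewrite lerDr.
Qed.

Let mf k : measurable_fun setT (f k).
Proof.
apply: measurable_funM; last exact: measurable_cst.
by apply: measurable_deg_falling_fact; apply: measurable_funB.
Qed.

Lemma deg_falling_fact_integrable k :
  P.-integrable setT (fun w => (deg_falling_fact lam (x - Y w) k)%:E).
Proof.
have [G [q q2 [intG f_le]]] := deg_falling_fact_dominated.
have := dominated_coef_integrable _ _ _ _ f G q mf intG f_le k.
move=> /(integrableZl measurableT (k`!%:R : R)); apply: eq_integrable => // w _.
by rewrite /= /f -EFinM mulrC divfK // pnatr_eq0 -lt0n fact_gt0.
Qed.

(** The sequence on the right has the defining generating function, because the
    factor 1 / (1 - t) takes partial sums of the coefficients a m / m! of
    the expectation; by uniqueness of power series it is the chosen one. *)
Lemma prob_deg_derangementE n :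
  prob_deg_derangement Y lam n x = n`!%:R * \sum_(m < n.+1) a m / m`!%:R.
Proof.
have [G [q q2 [intG f_le]]] := deg_falling_fact_dominated.
have fact_neq0 m : m`!%:R != 0 :> R by rewrite pnatr_eq0 -lt0n fact_gt0.
have q0 : 0 < q by apply: lt_le_trans q2.
have Ef k : fine 'E_P[f k]%E = a k / k`!%:R.
  have intk := deg_falling_fact_integrable k.
  have -> : f k = k`!%:R^-1 \o* (fun w => deg_falling_fact lam (x - Y w) k) by [].
  rewrite expectationZl; last exact/Lfun1_integrable.
  by rewrite fineM // /a ?unlock ?integrable_fin_num //= mulrC.
have closed_form : is_prob_deg_derangement Y lam x
    (fun n => n`!%:R * \sum_(m < n.+1) a m / m`!%:R).
  have : \forall t \near (0 : R), `|t| < (2 * q)^-1.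
    apply/nbhs_ballP; exists (2 * q)^-1 => /=; first by rewrite invr_gt0 mulr_gt0.
    by move=> t; rewrite /ball /= sub0r normrN.
  apply: filterS => t t_lt.
  have qt : q * `|t| <= 2^-1.
    by rewrite -ler_pdivlMl // -invfM mulrC ltW.
  have [E_fin E_cvg] := dominated_expectation_pseries _ _ _ _ f G q mf intG (ltW q0) f_le t qt.
  split=> //.
  have -> : (fun n => n`!%:R * (\sum_(m < n.+1) a m / m`!%:R) / n`!%:R) =
      (fun n => \sum_(m < n.+1) fine 'E_P[f m]%E).
    apply/funext => m; rewrite mulrC mulKf //.
    by apply: eq_bigr => i _; rewrite Ef.
  have Ef_le k := dominated_coef_expectation_le _ _ _ _ f G q mf intG f_le k.
  by apply: (cvg_pseries_partial_sums _ _ q _ _ q2 Ef_le _ E_cvg); lra.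
rewrite /prob_deg_derangement.
set D := xget _ _.
have D_def : is_prob_deg_derangement Y lam x D.
  apply: (@xgetPex _ _ [set D | is_prob_deg_derangement Y lam x D]).
  by exists (fun n => n`!%:R * \sum_(m < n.+1) a m / m`!%:R).
suff -> : D = fun n => n`!%:R * \sum_(m < n.+1) a m / m`!%:R by [].
have coef_eq := @pseries_coef_unique R (fun n => D n / n`!%:R)
  (fun n => n`!%:R * (\sum_(m < n.+1) a m / m`!%:R) / n`!%:R)
  (fun t => (1 - t)^-1 * fine 'E_P[fun w => deg_exp lam (x - Y w) t]%E).
apply/funext => m; apply: (mulIf (invr_neq0 (fact_neq0 m))).
apply: (congr1 (fun h => h m) (coef_eq _ _)).
  by apply: filterS D_def => t [].
by apply: filterS closed_form => t [].
Qed.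

End derangement.

Theorem theorem2p3 (d : measure_display) (T : measurableType d) (R : realType)
    (P : probability T R) (Y : {RV P >-> R}) (lam : R)
    (lam_neq0 : lam != 0)
    (mgfY : exists2 r : R, 0 < r &
       forall t : R, `|t| < r -> ('M_P Y t < +oo)%E)
    (x : R) (n : nat) :
  ((\sum_(j < n.+1) \sum_(l < j.+1)
      'C(n, j)%:R * deg_stirling2 lam j l * deg_falling_fact lam 1 (n - j) *
      (-1) ^+ l * prob_deg_derangement Y lam l x)%:E =
   \sum_(k < n.+1)
      'E_P[fun w => deg_falling_fact lam (x - Y w) k] *
      ((-1) ^+ k * deg_stirling2 lam n k)%:E)%E.
Proof.
pose a k := fine 'E_P[fun w => deg_falling_fact lam (x - Y w) k]%E.
have fact_neq0 m : m`!%:R != 0 :> R by rewrite pnatr_eq0 -lt0n fact_gt0.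
rewrite (deg_stirling2_derangement_sum lam (fun l => prob_deg_derangement Y lam l x) a).
- rewrite -sumEFin; apply: eq_bigr => k _; rewrite EFinM fineK //.
  by rewrite unlock; apply: integrable_fin_num => //; exact: deg_falling_fact_integrable.
- by rewrite prob_deg_derangementE // big_ord_recl big_ord0 /= fact0 mul1r divr1 addr0.
move=> k; rewrite !prob_deg_derangementE // big_ord_recr /= mulrDr.
by rewrite [X in _ + X]mulrC divfK // factS natrM -mulrA.
Qed.
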